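(* Let $\Phi:\mathbb{X}\to\overline{\mathbb{R}}$ be proper, lower semicontinuous and bounded from below. If $\Phi$ is prox-regular at $x^*\in\mathbb{X}$ for $0$, then there exist $\kappa>0$ and $\varepsilon>0$ such that for all $x,y\in\mathbb{B}(x^*,\varepsilon)$ with $\Phi(x)<\Phi(x^* )+\varepsilon$, $\Phi(y)<\Phi(x^* )+\varepsilon$ and ${\rm dist}(0,\partial\Phi(x))+{\rm dist}(0,\partial\Phi(y))<\varepsilon$, $$\Phi(x)-\Phi(y)\le\kappa\big[{\rm dist}(0,\partial\Phi(x))^2+{\rm dist}(0,\partial\Phi(y))\|x-y\|+\|x-y\|^2\big].$$
   Context: $\mathbb{X}$ is a finite-dimensional real inner product space with induced norm $\|\cdot\|$, $\mathbb{B}(x,\varepsilon)$ is the $\varepsilon$-ball centered at $x$, $\overline{\mathbb{R}}=(-\infty,\infty]$, $\partial$ denotes the limiting (Mordukhovich) subdifferential, and ${\rm dist}(0,\emptyset)=\infty$. A function $h:\mathbb{X}\to\overline{\mathbb{R}}$ is prox-regular at $\overline{x}$ for $\overline{v}$ if $h$ is finite and locally lower semicontinuous at $\overline{x}$ with $\overline{v}\in\partial h(\overline{x})$, and there exist $\varepsilon>0$ and $r\ge0$ such that, whenever $(x,v)\in\mathbb{B}((\overline{x},\overline{v}),\varepsilon)$ with $v\in\partial h(x)$ and $h(x)<h(\overline{x})+\varepsilon$, one has $h(x')\ge h(x)+\langle v,x'-x\rangle-\frac{r}{2}\|x'-x\|^2$ for all $x'\in\mathbb{B}(\overline{x},\varepsilon)$.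 *)

(* Defs.v *)
From HB Require Import structures.
From mathcomp Require Import all_boot all_order all_algebra sesquilinear.
From mathcomp Require Import all_classical all_reals all_analysis.

Set Implicit Arguments.
Unset Strict Implicit.
Unset Printing Implicit Defensive.

Import Order.TTheory GRing.Theory Num.Theory.
Import numFieldNormedType.Exports.

Local Open Scope classical_set_scope.
Local Open Scope ring_scope.

(* Finite dimension comes from [Vector], the topology and the norm from
   [NormedModule]; [inner_normE] says that the norm is the one induced by the
   inner product. *)
HB.mixin Record NormedVector_hasInner (R : realType) X
    of NormedModule R X & Vector R X := {
  inner : {dot X for idfun} ;
  inner_normE : forall x : X, inner x x = `|x| ^+ 2
}.

#[short(type="euclideanType")]
HB.structure Definition Euclidean (R : realType) :=
  { X of NormedModule R X & Vector R X & NormedVector_hasInner R X }.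

Section variational.
Context {R : realType} {X : euclideanType R}.
Implicit Types (f : X -> \bar R) (x v : X).

(* Functions into (-oo, +oo] are encoded as functions into [\bar R] that do not
   take the value -oo. *)
Definition proper_fun f : Prop :=
  (forall x, f x != -oo%E) /\ (exists x, f x \is a fin_num).

Definition bounded_below f : Prop := exists m : R, forall x, (m%:E <= f x)%E.

Definition regular_subdiff f x : set X := [set v | f x \is a fin_num /\
  (0 <= limf_einf (fun y => (f y - f x - (inner v (y - x))%:E) * `|y - x|^-1%:E)
          x^')%E].

Definition limiting_subdiff f x : set X := [set v | f x \is a fin_num /\
  exists xs vs : nat -> X,
    [/\ xs @ \oo --> x, f \o xs @ \oo --> f x,
        forall k, regular_subdiff f (xs k) (vs k) & vs @ \oo --> v]].

(* Only used at points where [f] is finite. *)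
Definition locally_lsc f x : Prop :=
  exists2 e : R, 0 < e & forall a : R, (a%:E <= f x + e%:E)%E ->
    closed [set y | closed_ball x e y /\ (f y <= a%:E)%E].

(* The pair (x, v) ranges over a ball of the product inner product space
   X * X, hence the Euclidean product norm. *)
Definition prox_regular f (xb vb : X) : Prop :=
  [/\ f xb \is a fin_num, locally_lsc f xb, limiting_subdiff f xb vb &
   exists e r : R, [/\ 0 < e, 0 <= r &
     forall x v, `|x - xb| ^+ 2 + `|v - vb| ^+ 2 < e ^+ 2 ->
       limiting_subdiff f x v -> (f x < f xb + e%:E)%E ->
       forall x', ball xb e x' ->
         (f x + (inner v (x' - x))%:E - (r / 2 * `|x' - x| ^+ 2)%:E <= f x')%E]].

(* [+oo] when the subdifferential is empty. *)
Definition dist0_subdiff f x : \bar R := edist_inf (limiting_subdiff f x) 0.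

End variational.

(* Main.v *)
Require Import Defs.
From mathcomp Require Import all_boot all_order all_algebra.
From mathcomp Require Import all_classical all_reals all_analysis.
From mathcomp Require Import lra.

Import Order.TTheory GRing.Theory Num.Theory.
Import numFieldNormedType.Exports.

Local Open Scope classical_set_scope.
Local Open Scope ring_scope.

(** The estimate follows from the prox-regularity inequality at [x] alone, with
    test point [y]. If [v] is a subgradient at [x] with [x], [v] and [Phi x]
    within the localisation, then
      Phi x - Phi y <= - <v, y - x> + r / 2 * |x - y| ^ 2
                    <= |v| ^ 2 / 2 + (1 + r) / 2 * |x - y| ^ 2,
    the second step being Young's inequality. The distance from 0 to the
    subdifferential at [x] is less than [eps], so subgradients of norm
    arbitrarily close to that distance exist and are small enough to be
    admissible; letting |v| decrease to the distance gives the bound with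
    kappa = (1 + r) / 2, to which a nonnegative multiple of |x - y| may be
    added. *)

Section subgradients.
Context {R : realType} {X : euclideanType R}.
Implicit Types (f : X -> \bar R) (x y u v w : X).

Lemma inner_young v w : - inner v w <= (`|v| ^+ 2 + `|w| ^+ 2) / 2.
Proof.
have innerC : inner w v = inner v w.
  by rewrite hermC /= expr0 mul1r.
have := sqr_ge0 `|v + w|.
rewrite -inner_normE linearDr !linearDl /= !inner_normE innerC => h.
lra.
Qed.

Lemma dist0_subdiff_lt_ex f x (c : R) : (dist0_subdiff f x < c%:E)%E ->
  exists2 v, limiting_subdiff f x v & `|v| < c.
Proof.
move=> /ereal_inf_lt[_ [v fv <-] /edist_lt_ball /=].
by rewrite -ball_normE /= sub0r normrN => vc; exists v.
Qed.

(** Norms of subgradients come arbitrarily close to the distance [d], so if the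
    conclusion failed, one of norm below both [e] and [sqrt (2 * A)], which then
    exceeds [d], would contradict the hypothesis. *)
Lemma le_dist0_sqr f x (e A d : R) :
    dist0_subdiff f x = d%:E -> d < e ->
    (forall v, limiting_subdiff f x v -> `|v| < e -> A <= `|v| ^+ 2 / 2) ->
  A <= d ^+ 2 / 2.
Proof.
move=> dE de bound; rewrite leNgt; apply/negP => dA.
have d0 : 0 <= d by rewrite -lee_fin -dE edist_inf_ge0.
have A0 : 0 <= 2 * A by have := sqr_ge0 d; lra.
have dsqrt : d < Num.sqrt (2 * A).
  by rewrite -(ger0_norm d0) -sqrtr_sqr ltr_sqrt; have := sqr_ge0 d; lra.
have [|v fv] := @dist0_subdiff_lt_ex f x (Num.min (Num.sqrt (2 * A)) e).
  by rewrite dE lte_fin lt_min dsqrt de.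
rewrite lt_min => /andP[vA ve].
have := bound v fv ve.
have : `|v| ^+ 2 < 2 * A.
  by rewrite -[ltRHS]sqr_sqrtr// ltr_pXn2r ?nnegrE ?sqrtr_ge0.
lra.
Qed.

End subgradients.

Theorem proposition8 (R : realType) (X : euclideanType R) (Phi : X -> \bar R)
    (Phi_proper : proper_fun Phi) (Phi_lsc : lower_semicontinuous Phi)
    (Phi_bounded : bounded_below Phi)
    (xstar : X) (Phi_prox : prox_regular Phi xstar 0) :
  exists kappa eps : R, [/\ 0 < kappa, 0 < eps &
    forall x y : X, ball xstar eps x -> ball xstar eps y ->
      (Phi x < Phi xstar + eps%:E)%E ->
      (Phi y < Phi xstar + eps%:E)%E ->
      (dist0_subdiff Phi x + dist0_subdiff Phi y < eps%:E)%E ->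
      (Phi x - Phi y <=
        kappa%:E * (dist0_subdiff Phi x ^+ 2
                    + dist0_subdiff Phi y * `|x - y|%:E
                    + (`|x - y| ^+ 2)%:E))%E].
Proof.
have [PhiNNy _] := Phi_proper.
have [xstar_fin _ _ [e [r [e0 r0 prox]]]] := Phi_prox.
(* Halving [e] puts the pair (x, v) in the ball of radius [e] of the product. *)
exists ((1 + r) / 2), (e / 2); split; [lra|lra|].
move=> x y xball yball Phix_lt Phiy_lt dist_lt.
have Phi_fin z : (Phi z < Phi xstar + (e / 2)%:E)%E -> Phi z \is a fin_num.
  move=> zlt; rewrite fin_numE PhiNNy /= -ltey.
  by rewrite (lt_le_trans zlt)// leey.
have dxge0 : (0 <= dist0_subdiff Phi x)%E by exact: edist_inf_ge0.
have dyge0 : (0 <= dist0_subdiff Phi y)%E by exact: edist_inf_ge0.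
have dx_lt : (dist0_subdiff Phi x < (e / 2)%:E)%E.
  by apply: le_lt_trans dist_lt; rewrite leeDl.
have dy_lt : (dist0_subdiff Phi y < (e / 2)%:E)%E.
  by apply: le_lt_trans dist_lt; rewrite leeDr.
have fin_of z : (0 <= z)%E -> (z < (e / 2)%:E)%E -> z \is a fin_num.
  by move=> z0 zlt; rewrite ge0_fin_numE// (lt_le_trans zlt)// leey.
have dxE := fineK (fin_of _ dxge0 dx_lt).
have dyE := fineK (fin_of _ dyge0 dy_lt).
have PhixE := fineK (Phi_fin x Phix_lt).
have PhiyE := fineK (Phi_fin y Phiy_lt).
move: dxE dyE PhixE PhiyE.
set dx := fine (dist0_subdiff Phi x); set dy := fine (dist0_subdiff Phi y).
set a := fine (Phi x); set b := fine (Phi y) => dxE dyE PhixE PhiyE.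
have bound : a - b - (1 + r) / 2 * `|x - y| ^+ 2 <= dx ^+ 2 / 2.
  apply: (@le_dist0_sqr R X Phi x (e / 2)) => //.
    by rewrite -lte_fin dxE.
  move=> v xv v_lt.
  have x_lt : `|x - xstar| < e / 2.
    by move: xball; rewrite -ball_normE /= distrC.
  have inball : `|x - xstar| ^+ 2 + `|v - 0| ^+ 2 < e ^+ 2.
    rewrite subr0.
    have := normr_ge0 v; have := normr_ge0 (x - xstar); nra.
  have Phix_lte : (Phi x < Phi xstar + e%:E)%E.
    by apply: lt_le_trans Phix_lt _; rewrite leeD2l// lee_fin; lra.
  have yballe : ball xstar e y by apply: le_ball yball; lra.
  have := prox x v inball xv Phix_lte y yballe.
  rewrite -PhixE -PhiyE -!EFinD lee_fin distrC.
  have := inner_young v (y - x); rewrite (distrC y x).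
  lra.
rewrite -PhixE -PhiyE -dxE -dyE -EFin_expe -(EFinM dy) -!EFinD -EFinM lee_fin.
have dy0 : 0 <= dy * `|x - y| by rewrite mulr_ge0// -lee_fin dyE.
have := sqr_ge0 dx.
nra.
Qed.
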